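(* Let $(K,\mathscr T)$ be a stable compact stable topological space and $M$ a stable subset of $\mathscr C(K,L^0)$. Then $M$ is stable totally bounded with respect to the stable metric $d_\infty(f,g)=\max\{|f(x)-g(x)|:x\in K\}$ if and only if (i) for each $x\in K$ the set $M_x=\{f(x):f\in M\}$ is bounded, i.e. there is $r_x\in L^0$ with $|f(x)|\le r_x$ for all $f\in M$; and (ii) $M$ is stable equicontinuous.
   Context: $L^0$: real measurable functions on a probability space modulo a.e. equality, a.e. order, $L^0_{++}=\{r>0\text{ a.e.}\}$; $L^0$ carries the topology with base $\{s:|s-t|<r\}$, $t\in L^0$, $r\in L^0_{++}$. An $L^0$-module is stable if for each countable measurable partition $(A_k)$ and $(x_k)$ there is a unique $x=\sum_k1_{A_k}x_k$ with $1_{A_k}x=1_{A_k}x_k$; nonempty subsets closed under concatenation are stable; for stable $Y_k$, $\sum_k1_{A_k}Y_k=\{\sum_k1_{A_k}y_k:y_k\in Y_k\}$; a nonempty collection of stable sets is stable if closed under this operation; a map $f$ is stable if $f(\sum_k1_{A_k}x_k)=\sum_k1_{A_k}f(x_k)$. A stable topological space is a stable subset $K$ of a stable $L^0$-module with a topology having a base which is a stable collection of stable sets; it is stable compact if every stable filter (a filter with a filter base which is a stable collection of stable sets) has a cluster point in $K$. $\mathscr C(K,L^0)$ is the stable $L^0$-module of stable continuous $f:K\to L^0$; for stable compact $K$ the maximum in $d_\infty$ is attained and $d_\infty$ is a stable metric. $\mathrm{st}(X)$ denotes the concatenations of elements of $X$; a subset $N\subset M$ is stable finite if $N=\{\sum_k1_{A_k}y_k:y_k\in\mathrm{st}(X_k)\}$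 with finite nonempty $X_k\subset M$. $M$ is stable totally bounded for $d_\infty$ if for every $r\in L^0_{++}$ there is a stable finite $N\subset M$ with $M=\bigcup_{g\in N}\{f:d_\infty(f,g)<r\}$. $M$ is stable equicontinuous if for every $x\in K$ and $r\in L^0_{++}$ there is a neighbourhood $V$ of $x$ with $|f(x)-f(y)|\le r$ for all $y\in V$ and $f\in M$. *)

(* Defs.v *)
From HB Require Import structures.
From mathcomp Require Import all_boot all_order all_algebra ring_quotient generic_quotient.
From mathcomp Require Import all_classical all_reals all_analysis measurable_realfun.
Set Implicit Arguments. Unset Strict Implicit. Unset Printing Implicit Defensive.
Import Order.TTheory GRing.Theory Num.Theory.
Local Open Scope classical_set_scope.
Local Open Scope ring_scope.
Local Open Scope quotient_scope.

(* L^0 over a probability space (T, P): measurable real functions modulo     *)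
(* P-a.e. equality, built as the quotient of the commutative ring            *)
(* {mfun T >-> R} by the ideal of functions vanishing P-a.e.                 *)

Section L0_ideal.
Context {R : realType} {d : measure_display} {T : measurableType d}.
Variable (P : probability T R).

Definition aenull (f : {mfun T >-> R}) : bool := `[< {ae P, forall w, f w = 0} >].

Lemma aenull_idealr_closed : @idealr_closed {mfun T >-> R} aenull.
Proof.
split.
- by apply/asboolP; apply: aeW.
- apply/negP => /asboolP h.
  have : ProperFilter (almost_everywhere P).
    apply: ae_properfilter_algebraOfSetsType; have := probability_setT P.
    by rewrite /= => ->; exact: lte01.
  move=> PF; have := @filter_not_empty _ _ PF.
  by apply; apply: filterS h => w /= /eqP; rewrite oner_eq0.
- move=> a u v /asboolP hu /asboolP hv; apply/asboolP.
  apply: filterS2 hu hv => w hu hv.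
  by rewrite mfunD mfunM /= hu hv mulr0 addr0.
Qed.
End L0_ideal.

Definition aenullI (R : realType) (d : measure_display) (T : measurableType d)
    (P : probability T R) : idealr {mfun T >-> R} :=
  HB.pack (aenull P)
    (isIdealr.Build {mfun T >-> R} (aenull P) (aenull_idealr_closed P)).

Definition L0 (R : realType) (d : measure_display) (T : measurableType d)
    (P : probability T R) := {ideal_quot (aenullI P)}.

Section L0_defs.
Context {R : realType} {d : measure_display} {T : measurableType d}.
Context {P : probability T R}.
Local Notation L := (L0 P).

Definition rep (s : L) : T -> R := (repr s : {mfun T >-> R}).

Definition le0 (s t : L) : Prop := {ae P, forall w, rep s w <= rep t w}.
Definition lt0 (s t : L) : Prop := {ae P, forall w, rep s w < rep t w}.

Definition pos0 (r : L) : Prop := lt0 0 r.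

Definition abs0 (s : L) : L :=
  \pi_L (@max_mfun _ T R (repr s) (- repr s)).

(* indicator 1_A in L^0 (A is always measurable where it is used) *)
Definition ind (A : set T) : L :=
  match pselect (measurable A) with
  | left mA => \pi_L (@indic_mfun _ T R A mA)
  | right _ => 0
  end.

Definition partition (A : nat -> set T) : Prop :=
  (forall k, measurable (A k)) /\ trivIset setT A /\ \bigcup_k A k = setT.

Section Module.
Variable E : lmodType L.

(* y = sum_k 1_{A_k} x_k *)
Definition is_concat (A : nat -> set T) (x : nat -> E) (y : E) : Prop :=
  forall k, ind (A k) *: y = ind (A k) *: x k.

Definition stable_module : Prop :=
  forall A, partition A -> forall x : nat -> E, exists! y, is_concat A x y.

Definition stable_set (S : set E) : Prop :=
  S !=set0 /\
  forall A, partition A -> forall x : nat -> E, (forall k, S (x k)) ->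
    forall y, is_concat A x y -> S y.

Definition concat_set (A : nat -> set T) (Y : nat -> set E) : set E :=
  [set y | exists x : nat -> E, (forall k, Y k (x k)) /\ is_concat A x y].

Definition stable_collection (C : set (set E)) : Prop :=
  C !=set0 /\ (forall Y, C Y -> stable_set Y) /\
  forall A, partition A -> forall Y : nat -> set E, (forall k, C (Y k)) ->
    C (concat_set A Y).

Definition is_topology (K : set E) (tau : set (set E)) : Prop :=
  (forall O, tau O -> O `<=` K) /\ tau K /\ tau set0 /\
  (forall F : set (set E), F `<=` tau -> tau (\bigcup_(O in F) O)) /\
  (forall O1 O2, tau O1 -> tau O2 -> tau (O1 `&` O2)).

Definition is_base (K : set E) (tau : set (set E)) (B : set (set E)) : Prop :=
  B `<=` tau /\
  forall O, tau O -> forall x, O x -> exists2 U, B U & U x /\ U `<=` O.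

Definition stable_top_space (K : set E) (tau : set (set E)) : Prop :=
  stable_set K /\ is_topology K tau /\
  exists B, is_base K tau B /\ stable_collection B.

Definition is_filter (K : set E) (F : set (set E)) : Prop :=
  (forall S, F S -> S `<=` K) /\ F K /\ ~ F set0 /\
  (forall S1 S2, F S1 -> F S2 -> F (S1 `&` S2)) /\
  (forall S1 S2, F S1 -> S1 `<=` S2 -> S2 `<=` K -> F S2).

Definition stable_filter (K : set E) (F : set (set E)) : Prop :=
  is_filter K F /\
  exists Bf : set (set E), Bf `<=` F /\
    (forall S, F S -> exists2 U, Bf U & U `<=` S) /\ stable_collection Bf.

Definition cluster_point (K : set E) (tau : set (set E)) (F : set (set E))
    (x : E) : Prop :=
  K x /\ forall O, tau O -> O x -> forall S, F S -> (O `&` S) !=set0.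

Definition stable_compact (K : set E) (tau : set (set E)) : Prop :=
  forall F, stable_filter K F -> exists x, cluster_point K tau F x.

Definition nbhd (K : set E) (tau : set (set E)) (x : E) (V : set E) : Prop :=
  V `<=` K /\ exists O, tau O /\ O x /\ O `<=` V.

Definition ball0 (t r : L) : set L := [set s | lt0 (abs0 (s - t)) r].

Definition open0 (O : set L) : Prop :=
  forall s, O s -> exists t r, pos0 r /\ ball0 t r s /\ ball0 t r `<=` O.

(* functions K -> L^0 are represented by functions E -> L^0 (only their
   values on K matter) *)
Definition stable_fun (K : set E) (f : E -> L) : Prop :=
  forall A, partition A -> forall x : nat -> E, (forall k, K (x k)) ->
    forall y, is_concat A x y -> forall k, ind (A k) * f y = ind (A k) * f (x k).

Definition continuous0 (K : set E) (tau : set (set E)) (f : E -> L) : Prop :=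
  forall O, open0 O -> tau (K `&` f @^-1` O).

Definition CK (K : set E) (tau : set (set E)) : set (E -> L) :=
  [set f | stable_fun K f /\ continuous0 K tau f].

Definition fconcat (K : set E) (A : nat -> set T) (g : nat -> E -> L)
    (f : E -> L) : Prop :=
  forall k x, K x -> ind (A k) * f x = ind (A k) * g k x.

Definition stable_subset_CK (K : set E) (tau : set (set E))
    (M : set (E -> L)) : Prop :=
  M !=set0 /\ M `<=` CK K tau /\
  forall A, partition A -> forall g : nat -> E -> L, (forall k, M (g k)) ->
    forall f, CK K tau f -> fconcat K A g f -> M f.

(* d_oo(f, g) = max {|f x - g x| : x in K} (attained when K is stable
   compact) *)
Definition dinf (K : set E) (f g : E -> L) : L :=
  xget 0 [set m | (exists2 x, K x & m = abs0 (f x - g x)) /\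
                  forall x, K x -> le0 (abs0 (f x - g x)) m].

Definition st (K : set E) (X : set (E -> L)) : set (E -> L) :=
  [set f | exists A, partition A /\
     exists g : nat -> E -> L, (forall k, X (g k)) /\ fconcat K A g f].

Definition stable_finite (K : set E) (M N : set (E -> L)) : Prop :=
  N `<=` M /\
  exists A, partition A /\
  exists X : nat -> set (E -> L),
    (forall k, finite_set (X k) /\ X k !=set0 /\ X k `<=` M) /\
    N = [set f | exists y : nat -> E -> L,
                   (forall k, st K (X k) (y k)) /\ fconcat K A y f].

Definition stable_totally_bounded (K : set E) (M : set (E -> L)) : Prop :=
  forall r, pos0 r -> exists N, stable_finite K M N /\
    M = \bigcup_(g in N) [set f | M f /\ lt0 (dinf K f g) r].

Definition L0_pointwise_bounded (K : set E) (M : set (E -> L)) : Prop :=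
  forall x, K x -> exists rx : L, forall f, M f -> le0 (abs0 (f x)) rx.

Definition stable_equicontinuous (K : set E) (tau : set (set E))
    (M : set (E -> L)) : Prop :=
  forall x, K x -> forall r, pos0 r -> exists V, nbhd K tau x V /\
    forall y f, V y -> M f -> le0 (abs0 (f x - f y)) r.

End Module.
End L0_defs.

(* Main.v *)
(* Every statement is localized to measurable sets and globalized by exhaustion:
   a hereditary property which holds on some nonnull part of every nonnull set
   holds on all pieces of a countable partition.

   Cluster points of the stable filter generated by the sets {h >= h(y)} show
   that d_oo is attained, so total boundedness gives boundedness and
   equicontinuity by the usual three-term estimate, the neighbourhood of x being
   a concatenation of neighbourhoods adapted to finitely many functions.

   Conversely, equicontinuity yields a partition (A_k) and finite sets X_k of
   points such that on A_k every y in K is close to X_k, uniformly over M: if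
   this failed on every nonnull part of some nonnull B, the sets of points which
   are on B far from a stably finite set of points would generate a stable
   filter, and a cluster point of it would be far on B from points arbitrarily
   near to it.  On a smaller piece the bounds at the points of X_k are real
   constants, so the values of f in M there are encoded by finitely many grid
   vectors; for each vector an element of M realizing it wherever possible is
   glued together, and these finitely many elements form a net. *)

Require Import Defs.
From HB Require Import structures.
From mathcomp Require Import all_boot all_order all_algebra ring_quotient generic_quotient.
From mathcomp Require Import all_classical all_reals all_analysis measurable_realfun.
From mathcomp Require Import lra.
Import Defs Order.TTheory GRing.Theory Num.Theory.
Local Open Scope classical_set_scope.
Local Open Scope ring_scope.
Local Open Scope quotient_scope.

Set Implicit Arguments.
Unset Strict Implicit.
Unset Printing Implicit Defensive.

(** Turns the a.e. fact [H] into a pointwise premise of an a.e. goal; iterating it merges the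
    exceptional null sets. *)
Ltac ae_use H := apply: (filter_app _ _ H).

(** * Almost everywhere calculus for representatives of elements of [L0] *)

Section L0_representatives.
Context {R : realType} {d : measure_display} {T : measurableType d}.
Context {P : probability T R}.
Local Notation L := (L0 P).
Implicit Types (s t r : L) (A C D : set T).

(** [repr (\pi_L f) - f] lies in the ideal, so it vanishes a.e.; the pointwise rules for the
    operations below rest on this. *)
Lemma rep_pi (f : {mfun T >-> R}) : {ae P, forall w, rep (\pi_L f) w = f w}.
Proof.
have : (repr (\pi_L f) - f \in aenullI P) by rewrite Quotient.idealrBE reprK.
move=> /asboolP; apply: filterS => w.
by rewrite mfunB /= => /eqP; rewrite subr_eq0 => /eqP.
Qed.

Lemma L0_eq s t : {ae P, forall w, rep s w = rep t w} -> s = t.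
Proof.
move=> h; rewrite -[s]reprK -[t]reprK; apply/eqP.
rewrite -Quotient.idealrBE; apply/asboolP; move: h; apply: filterS => w.
by rewrite mfunB /rep /= => ->; rewrite subrr.
Qed.

Lemma rep0 : {ae P, forall w, rep (0 : L) w = 0}.
Proof.
have := rep_pi 0; rewrite raddf0; apply: filterS => w ->.
by rewrite mfun0.
Qed.

Lemma rep1 : {ae P, forall w, rep (1 : L) w = 1}.
Proof.
have := rep_pi 1; rewrite rmorph1; apply: filterS => w ->.
by rewrite mfun1.
Qed.

Lemma repD s t : {ae P, forall w, rep (s + t) w = rep s w + rep t w}.
Proof.
have e : \pi_L (repr s + repr t) = s + t by rewrite raddfD /= !reprK.
have := rep_pi (repr s + repr t); rewrite e.
by apply: filterS => w ->; rewrite mfunD.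
Qed.

Lemma repB s t : {ae P, forall w, rep (s - t) w = rep s w - rep t w}.
Proof.
have e : \pi_L (repr s - repr t) = s - t by rewrite raddfB /= !reprK.
have := rep_pi (repr s - repr t); rewrite e.
by apply: filterS => w ->; rewrite mfunB.
Qed.

Lemma repM s t : {ae P, forall w, rep (s * t) w = rep s w * rep t w}.
Proof.
have e : \pi_L (repr s * repr t) = s * t by rewrite rmorphM /= !reprK.
have := rep_pi (repr s * repr t); rewrite e.
by apply: filterS => w ->; rewrite mfunM.
Qed.

Lemma rep_abs0 s : {ae P, forall w, rep (abs0 s) w = `|rep s w|}.
Proof.
apply: filterS (rep_pi (max_mfun (repr s) (- repr s))) => w ->.
by change (Num.max (rep s w) ((- repr s) w) = `|rep s w|); rewrite mfunN maxrN.
Qed.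

Lemma rep_abs0B s t :
  {ae P, forall w, rep (abs0 (s - t)) w = `|rep s w - rep t w|}.
Proof. by ae_use (rep_abs0 (s - t)); apply: filterS (repB s t) => w -> ->. Qed.

Lemma rep_ind A : measurable A -> {ae P, forall w, rep (ind A : L) w = \1_A w}.
Proof.
by move=> mA; rewrite /ind; case: pselect => // mA'; exact: rep_pi.
Qed.

Lemma measurable_rep s : measurable_fun setT (rep s).
Proof. exact: measurable_funP. Qed.

(** Translates the algebraic condition used for concatenations into a.e. equality on a piece, where
    estimates can be made. *)
Lemma ind_mulP A s t : measurable A ->
  ind A * s = ind A * t <-> {ae P, forall w, A w -> rep s w = rep t w}.
Proof.
move=> mA; split=> [e|e].
  have := repM (ind A) t; rewrite -e => h.
  ae_use h; ae_use (repM (ind A) s); apply: filterS (rep_ind mA) => w -> -> /[swap] Aw.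
  by rewrite indicE mem_set// !mul1r.
apply: L0_eq; ae_use (repM (ind A) s); ae_use (repM (ind A) t); ae_use (rep_ind mA).
apply: filterS e => w h -> -> ->; rewrite indicE.
by have [/set_mem/h ->|] := boolP (w \in A); rewrite ?mul0r.
Qed.

Lemma L0_of_measurable (f : T -> R) : measurable_fun setT f ->
  exists s : L, {ae P, forall w, rep s w = f w}.
Proof.
move=> mf; pose F : {mfun T >-> R} := HB.pack f (isMeasurableFun.Build _ _ _ _ f mf).
exists (\pi_L F); exact: rep_pi.
Qed.

Lemma L0_scale (c : R) s : exists t : L, {ae P, forall w, rep t w = c * rep s w}.
Proof.
by apply: L0_of_measurable; apply: measurable_funM; [exact: measurable_cst|exact: measurable_rep].
Qed.

Lemma partition_index (B : nat -> set T) : partition B ->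
  forall w, exists k, B k w.
Proof.
move=> [_ [_ U]] w; have : [set: T] w by [].
by rewrite -U => -[k _ Bk]; exists k.
Qed.

Lemma L0_glue (B : nat -> set T) (s : nat -> L) : partition B ->
  exists t : L, forall k, {ae P, forall w, B k w -> rep t w = rep (s k) w}.
Proof.
move=> [mB [tB UB]].
have idx w : {k | B k w}.
  apply: cid; have : [set: T] w by [].
  by rewrite -UB => -[k _ Bk]; exists k.
pose f w := rep (s (projT1 (idx w))) w.
have fE k w : B k w -> f w = rep (s k) w.
  move=> Bk; rewrite /f; case: (idx w) => j /= Bj.
  by rewrite (tB j k)//; exists w.
have mf : measurable_fun setT f.
  rewrite -UB; apply/measurable_fun_bigcup => // k.
  apply: (eq_measurable_fun (rep (s k))); first by move=> w /set_mem/fE.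
  exact: measurable_funS (measurable_rep _).
have [t ht] := L0_of_measurable mf.
by exists t => k; apply: filterS ht => w -> /fE.
Qed.

Lemma measurable_rep_le s t : measurable [set w | rep s w <= rep t w].
Proof.
have := measurable_fun_ler (measurable_rep s) (measurable_rep t) measurableT (Y := [set true]).
by rewrite setTI; exact.
Qed.

Lemma measurable_rep_lt s t : measurable [set w | rep s w < rep t w].
Proof.
have := measurable_fun_ltr (measurable_rep s) (measurable_rep t) measurableT (Y := [set true]).
by rewrite setTI; exact.
Qed.

Lemma L0_upper_bound (s t : L) : exists u : L, le0 s u /\ le0 t u.
Proof.
have [u hu] : exists u : L, {ae P, forall w, rep u w = Num.max (rep s w) (rep t w)}.
  by apply: L0_of_measurable; apply: measurable_maxr; exact: measurable_rep.
by exists u; split; apply: filterS hu => w ->; rewrite le_max lexx ?orbT.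
Qed.

Lemma le0_trans (s t u : L) : le0 s t -> le0 t u -> le0 s u.
Proof.
move=> st tu; rewrite /le0; ae_use tu.
by apply: filterS st => w; exact: le_trans.
Qed.

End L0_representatives.

(** * Exhaustion arguments in the probability space *)

Section Exhaustion.
Context {R : realType} {d : measure_display} {T : measurableType d}.
Context {P : probability T R}.
Implicit Types (A C D : set T).
Local Notation null C := {ae P, forall w, ~ C w}.

Lemma nullP C : measurable C -> null C <-> P C = 0%E.
Proof.
move=> mC; rewrite -(negligibleP P mC).
have E : ~` [set x | ~ C x] = C.
  by apply/seteqP; split=> w /=; [move=> /contrapT|move=> ? /(_ _)].
by rewrite -[X in _ <-> P.-negligible X]E.
Qed.

Lemma null_subset C D : C `<=` D -> null D -> null C.
Proof. by move=> CD; apply: filterS => w + /CD. Qed.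

(* A sequence of [Phi]-sets whose union has maximal probability absorbs every
   [Phi]-set; the piece [A 0] is what is left over. *)
Lemma exhaustion (Phi : set T -> Prop) :
  (forall A C, Phi A -> measurable C -> C `<=` A -> Phi C) -> Phi set0 ->
  exists A : nat -> set T,
    [/\ partition A, forall k, Phi (A k.+1) &
        forall C, measurable C -> Phi C -> {ae P, forall w, C w -> ~ A 0%N w}].
Proof.
move=> Phi_sub Phi0.
pose fam := [set F : nat -> set T | forall k, measurable (F k) /\ Phi (F k)].
pose V := [set x : R | exists2 F, fam F & x = fine (P (\bigcup_k F k))].
have supV : has_sup V.
  split; first by exists (fine (P (\bigcup_(k : nat) set0))); exists (fun=> set0).
  exists 1 => _ [F fF ->].
  have mF : measurable (\bigcup_k F k) by apply: bigcup_measurable => k _; case: (fF k).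
  by rewrite -lee_fin fineK ?probability_le1// fin_num_measure.
have /choice[F hF] : forall n : nat, exists F, fam F /\
    sup V - n.+1%:R^-1 < fine (P (\bigcup_k F k)).
  move=> n; have n0 : 0 < n.+1%:R^-1 :> R by rewrite invr_gt0.
  by have [_ [F fF ->] lt] := sup_adherent n0 supV; exists F.
(* One sequence enumerating all [F n j]; its union has probability above [sup V - 1/(n+1)] for every
   [n]. *)
pose G k := if unpickle k is Some (i, j) then F i j else set0.
have fG : fam G.
  by move=> k; rewrite /G; case: unpickle => [[i j]|]//; case: (hF i) => + _; apply.
have mG k : measurable (G k) by case: (fG k).
have mU : measurable (\bigcup_k G k) by exact: bigcup_measurable.
have FG n : \bigcup_k F n k `<=` \bigcup_k G k.
  move=> w [j _ Fw]; exists (pickle (n, j)) => //.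
  by rewrite /G pickleK.
have mD := seqDU_measurable mG.
(* Heredity of [Phi] allows passing from [G] to the disjoint sets [seqDU G]; the complement of the
   union takes index 0. *)
exists (fun k => if k is k'.+1 then seqDU G k' else ~` \bigcup_k G k); split.
- split; first by case=> //; exact: measurableC.
  split.
    rewrite seqDU_bigcup_eq => -[|i] [|j] _ _ // [w [/= h1 h2]].
    + by exfalso; apply: h1; exists j.
    + by exfalso; apply: h2; exists i.
    + by congr S; apply: (@trivIset_seqDU _ G) => //; exists w.
  apply/seteqP; split=> // w _.
  have [] := pselect ((\bigcup_k seqDU G k) w) => [[k _ Gk]|nG]; first by exists k.+1.
  by exists 0%N => //; rewrite seqDU_bigcup_eq.
- by move=> k; apply: Phi_sub (fG k).2 _ _; [exact: mD|exact: subset_seqDU].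
move=> C mC PC.
have mCU : measurable (C `\` \bigcup_k G k) by exact: measurableD.
suff CU : null (C `\` \bigcup_k G k) by apply: filterS CU => w h Cw nU; exact: h.
apply/(nullP mCU).
(* A competitor with [C] put in front of [G]: if [C] had a nonnull part outside the union, the
   probability of its union would exceed the supremum. *)
pose G' k := if k is k'.+1 then G k' else C.
have fG' : fam G' by case.
have UE : \bigcup_k G' k = (\bigcup_k G k) `|` (C `\` \bigcup_k G k).
  rewrite setUDr setDv setD0; apply/seteqP; split=> w.
    by case=> -[|k] _ /=; [right|left; exists k].
  by case=> [[k _ Gk]|Cw]; [exists k.+1|exists 0%N].
have ub : fine (P (\bigcup_k G' k)) <= sup V.
  by apply: sup_upper_bound => //; exists G'.
move: ub; rewrite UE measureU//; last by rewrite setDE setIA [X in X `&` _]setIC -setIA setICr setI0.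
rewrite fineD ?fin_num_measure// => ub.
have : 0 <= fine (P (C `\` \bigcup_k G k)) by rewrite fine_ge0.
rewrite le_eqVlt => /predU1P[e|gt0].
  by rewrite -[LHS]fineK ?fin_num_measure// -e.
have [n] := ltr_add_invr gt0; rewrite add0r => ltn.
have := (hF n).2 => lt2.
have le3 : fine (P (\bigcup_k F n k)) <= fine (P (\bigcup_k G k)).
  have mF : measurable (\bigcup_k F n k).
    by apply: bigcup_measurable => k _; case: (hF n) => /(_ k)[].
  by rewrite fine_le ?fin_num_measure// le_measure// inE.
have abs (a b c u e : R) : a + b <= u -> e < b -> u - e < c -> c <= a -> False.
  by clear => *; lra.
by case: (abs _ _ _ _ _ ub ltn lt2 le3).
Qed.

(** The leftover piece of [exhaustion] is null, since a nonnull [Phi]-subset of it would have to be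
    a.e. disjoint from it. *)
Lemma exhaustion_partition (Phi : set T -> Prop) :
  (forall A C, Phi A -> measurable C -> C `<=` A -> Phi C) ->
  (forall C, measurable C -> null C -> Phi C) ->
  (forall C, measurable C -> ~ null C ->
     exists D, [/\ measurable D, D `<=` C, ~ null D & Phi D]) ->
  exists A : nat -> set T, partition A /\ forall k, Phi (A k).
Proof.
move=> Phi_sub Phi_null Phi_dense.
have Phi0 : Phi set0 by apply: Phi_null; [exact: measurable0|apply: aeW => w []].
have [A [pA PA maxA]] := exhaustion Phi_sub Phi0.
exists A; split=> // -[|k]; last exact: PA.
have mA : measurable (A 0%N) by case: pA.
apply: Phi_null => //; apply: contrapT => nA.
have [D [mD DA nD PD]] := Phi_dense _ mA nA.
by apply: nD; apply: filterS (maxA _ mD PD) => w h Dw; exact: h Dw (DA _ Dw).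
Qed.

End Exhaustion.

(** * Concatenation, stable functions and attainment of maxima *)

Section Stable.
Context {R : realType} {d : measure_display} {T : measurableType d}.
Context {P : probability T R}.
Local Notation L := (L0 P).
Local Notation null C := {ae P, forall w, ~ C w}.
Implicit Types (r s t : L) (A C D : set T).

Lemma ae_partition (A : nat -> set T) (Q : T -> Prop) : partition A ->
  (forall k, {ae P, forall w, A k w -> Q w}) -> {ae P, forall w, Q w}.
Proof.
move=> pA /ae_foralln; apply: filterS => w h.
by have [k Ak] := partition_index pA w; exact: h Ak.
Qed.

Definition bipart A (k : nat) : set T :=
  match k with 0%N => A | 1%N => ~` A | _ => set0 end.

Lemma partition_bipart A : measurable A -> partition (bipart A).
Proof.
move=> mA; split; first by case=> [|[|k]] //=; exact: measurableC.
split; first by move=> [|[|i]] [|[|j]] _ _ //= [w []].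
apply/seteqP; split=> // w _; have [Aw|nAw] := pselect (A w); first by exists 0%N.
by exists 1%N.
Qed.

Lemma ind_mul_subset A C : measurable A -> measurable C -> C `<=` A ->
  ind C * ind A = ind C :> L.
Proof.
move=> mA mC CA; rewrite -[RHS]mulr1; apply/(ind_mulP _ _ mC).
ae_use (@rep1 _ _ _ P); apply: filterS (@rep_ind _ _ _ P _ mA) => w -> -> /CA Aw.
by rewrite indicE mem_set.
Qed.

Section Module.
Variable E : lmodType L.
Implicit Types (x y z : E) (K : set E) (tau : set (set E)) (f g : E -> L).

Lemma ind_scale_subset A C x y : measurable A -> measurable C -> C `<=` A ->
  ind A *: x = ind A *: y -> ind C *: x = ind C *: y.
Proof.
by move=> mA mC CA e; rewrite -(ind_mul_subset mA mC CA) -!scalerA e.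
Qed.

Lemma stable_concat K (A : nat -> set T) (x : nat -> E) :
  stable_module E -> stable_set K -> partition A -> (forall k, K (x k)) ->
  exists2 y, K y & is_concat A x y.
Proof.
move=> sE [_ sK] pA Kx; have [y [xy _]] := sE _ pA x.
by exists y => //; exact: sK xy.
Qed.

Lemma stable_concat2 K A x y : stable_module E -> stable_set K ->
  measurable A -> K x -> K y ->
  exists z, [/\ K z, ind A *: z = ind A *: x & ind (~` A) *: z = ind (~` A) *: y].
Proof.
move=> sE sK mA Kx Ky.
have [|z Kz h] := stable_concat (x := fun k => if k is 0%N then x else y) sE sK (partition_bipart mA).
  by case.
by exists z; split=> //; [exact: (h 0%N)|exact: (h 1%N)].
Qed.

Lemma stable_fun_concat K f (A : nat -> set T) (x : nat -> E) y :
  stable_fun K f -> partition A -> (forall k, K (x k)) -> is_concat A x y ->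
  forall k, {ae P, forall w, A k w -> rep (f y) w = rep (f (x k)) w}.
Proof.
move=> sf pA Kx xy k; apply/ind_mulP; first by case: pA.
exact: sf xy k.
Qed.

(** [x] is the concatenation of [y] on [A] with [x] itself off [A], so stability of [f] makes its
    values local. *)
Lemma stable_fun_local K f A x y : stable_fun K f -> measurable A ->
  K x -> K y -> ind A *: x = ind A *: y ->
  {ae P, forall w, A w -> rep (f x) w = rep (f y) w}.
Proof.
move=> sf mA Kx Ky xy.
apply: (stable_fun_concat (x := fun k => if k is 0%N then y else x) sf (partition_bipart mA) _ _ 0%N).
  by case.
by case.
Qed.

Lemma fconcatP K (A : nat -> set T) (g : nat -> E -> L) f : partition A ->
  fconcat K A g f <->
  forall k x, K x -> {ae P, forall w, A k w -> rep (f x) w = rep (g k x) w}.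
Proof.
move=> [mA _]; split=> h k x Kx; first by apply/ind_mulP => //; exact: h.
by apply/ind_mulP => //; exact: h.
Qed.

Lemma fconcat_exists K (A : nat -> set T) (g : nat -> E -> L) : partition A ->
  exists f, fconcat K A g f.
Proof.
move=> pA; have /choice[f hf] := fun x => L0_glue (fun k => g k x) pA.
by exists f; apply/fconcatP.
Qed.

Lemma CK_continuous_at K tau f x r : CK K tau f -> K x -> pos0 r ->
  exists O, [/\ tau O, O x & forall y, O y ->
    K y /\ {ae P, forall w, `|rep (f y) w - rep (f x) w| < rep r w}].
Proof.
move=> [_ cf] Kx r0; exists (K `&` f @^-1` ball0 (f x) r); split.
- by apply: cf => s hs; exists (f x), r; split=> //; split.
- split=> //=; rewrite /ball0 /= /lt0.
  ae_use r0; ae_use (@rep0 _ _ _ P); apply: filterS (rep_abs0B (f x) (f x)) => w ->.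
  by rewrite subrr normr0 => ->.
- move=> y [Ky]; rewrite /= /ball0 /= /lt0 => h; split=> //.
  by ae_use h; apply: filterS (rep_abs0B (f y) (f x)) => w ->.
Qed.

Lemma continuous0_local K tau f : is_topology K tau ->
  (forall x r, K x -> pos0 r -> exists O, [/\ tau O, O x & forall y, O y ->
    {ae P, forall w, `|rep (f y) w - rep (f x) w| < rep r w}]) ->
  continuous0 K tau f.
Proof.
move=> [tK [_ [_ [tU _]]]] h O oO.
set S := K `&` _.
have -> : S = \bigcup_(U in [set U | tau U /\ U `<=` S]) U.
  apply/seteqP; split=> [x [Kx /= Ox]|x [U [_ US] /US]//].
  have [t [r [_ [fxt tO]]]] := oO _ Ox.
  pose q := r - abs0 (f x - t).
  have q0 : pos0 q.
    rewrite /pos0 /lt0; ae_use (@rep0 _ _ _ P).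
    ae_use (repB r (abs0 (f x - t))); apply: filterS fxt => w lt -> ->.
    by rewrite subr_gt0.
  have [U [tauU Ux hU]] := h _ _ Kx q0.
  exists U => //; split=> // y Uy; split; first exact: tK Uy.
  apply: tO; rewrite /ball0 /= /lt0.
  ae_use (hU _ Uy); ae_use (repB r (abs0 (f x - t))); ae_use (rep_abs0B (f x) t).
  apply: filterS (rep_abs0B (f y) t) => w -> -> ->.
  have := ler_normD (rep (f y) w - rep (f x) w) (rep (f x) w - rep t w).
  rewrite addrA subrK; lra.
by apply: tU => U [].
Qed.

Lemma concat_set_const (A : nat -> set T) (U : nat -> set E) x :
  (forall k, U k x) -> concat_set A U x.
Proof. by move=> Ux; exists (fun=> x). Qed.

Lemma base_nbhd K tau B O x : is_base K tau B -> tau O -> O x ->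
  exists U, [/\ B U, U x & U `<=` O].
Proof. by move=> [_ hB] tO Ox; have [U BU [Ux UO]] := hB _ tO _ Ox; exists U. Qed.

(** Near [x] each [g k] is controlled on a base set [U k]. The base is a stable collection, so the
    concatenation of the [U k] is open, and there [f] inherits on [A k] the control of [g k]. *)
Lemma CK_fconcat K tau (A : nat -> set T) (g : nat -> E -> L) f :
  stable_top_space K tau -> partition A -> (forall k, CK K tau (g k)) ->
  fconcat K A g f -> CK K tau f.
Proof.
move=> [sK [top [B [bB [B0 [Bs Bc]]]]]] pA cg /(fconcatP _ _ _ pA) fg.
have sf : stable_fun K f.
  move=> A' pA' x Kx y xy j; have Ky : K y by case: sK => _ sK; exact: sK xy.
  apply/ind_mulP; first by case: pA'.
  apply: (ae_partition pA) => k.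
  ae_use (fg k y Ky); ae_use (fg k (x j) (Kx j)).
  apply: filterS (stable_fun_concat (cg k).1 pA' Kx xy j) => w h e1 e2 Aw A'w.
  by rewrite e2// h// e1.
split=> //; apply: continuous0_local => // x r Kx r0.
have /choice[U hU] : forall k, exists U, [/\ B U, U x & forall y, U y ->
    K y /\ {ae P, forall w, `|rep (g k y) w - rep (g k x) w| < rep r w}].
  move=> k; have [V [tO Ox hO]] := CK_continuous_at (cg k) Kx r0.
  by have [U [BU Ux UO]] := base_nbhd bB tO Ox; exists U; split=> // y /UO/hO.
exists (concat_set A U); split.
- by apply: bB.1; apply: Bc => // k; case: (hU k).
- by apply: concat_set_const => k; case: (hU k).
move=> y [z [Uz zy]].
have Kz k : K (z k) by case: (hU k) => _ _ /(_ _ (Uz k))[].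
have Ky : K y by case: sK => _ sK; exact: sK zy.
apply: (ae_partition pA) => k; have [_ _ /(_ _ (Uz k))[_ lt]] := hU k.
ae_use lt; ae_use (fg k y Ky); ae_use (fg k x Kx).
apply: filterS (stable_fun_concat (cg k).1 pA Kz zy k) => w e1 e2 e3 + Aw.
by rewrite e2// e3// e1.
Qed.

(** The supersets within [K] of members of a directed stable collection form a stable filter, so
    compactness can be applied to the collection directly. *)
Lemma compact_cluster K tau (B : set (set E)) :
  stable_compact K tau -> stable_collection B -> (forall U, B U -> U `<=` K) ->
  (forall U V, B U -> B V -> exists2 W, B W & W `<=` U `&` V) ->
  exists2 x, K x & forall O, tau O -> O x -> forall U, B U -> (O `&` U) !=set0.
Proof.
move=> cK sB BK Bdir.
pose F := [set S | S `<=` K /\ exists2 U, B U & U `<=` S].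
have sF : stable_filter K F.
  split; last first.
    exists B; split; first by move=> U BU; split; [exact: BK|exists U].
    by split=> // S [_].
  split; first by move=> S [].
  split; first by split=> //; case: sB => -[U BU] _; exists U => //; exact: BK.
  split.
    by move=> [_ [U BU U0]]; case: sB => _ [/(_ _ BU)[[x Ux] _] _]; exact: U0 Ux.
  split.
    move=> S1 S2 [S1K [U BU US]] [S2K [V BV VS]]; split; first by move=> x [/S1K].
    by have [W BW WUV] := Bdir _ _ BU BV; exists W => // x /WUV[/US ? /VS].
  move=> S1 S2 [S1K [U BU US]] S12 S2K; split=> //.
  by exists U => // x /US/S12.
have [x [Kx hx]] := cK _ sF.
by exists x => // O tO Ox U BU; apply: hx => //; split; [exact: BK|exists U].
Qed.

Lemma stable_max_attained K tau (h : E -> L) :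
  stable_module E -> stable_set K -> stable_compact K tau -> stable_fun K h ->
  (forall x r, K x -> pos0 r -> exists O, [/\ tau O, O x & forall y, O y ->
    {ae P, forall w, `|rep (h y) w - rep (h x) w| < rep r w}]) ->
  exists2 x, K x & forall y, K y -> le0 (h y) (h x).
Proof.
move=> sE sK cK sh ch.
pose S y := [set z | K z /\ le0 (h y) (h z)].
pose B := [set U | exists2 y, K y & U = S y].
have Sy y : K y -> S y y by move=> Ky; split=> //; exact: aeW.
have sB : stable_collection B.
  split; first by case: sK => -[y Ky] _; exists (S y); exists y.
  split=> [_ [y Ky ->]|A pA U BU].
    split; first by exists y; exact: Sy.
    move=> A pA z Sz x zx; have Kz k : K (z k) by case: (Sz k).
    split; first by case: sK => _; apply; [exact: pA|exact: Kz|].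
    apply: (ae_partition pA) => k; have [_ le] := Sz k.
    ae_use le; apply: filterS (stable_fun_concat sh pA Kz zx k) => w e + Aw.
    by rewrite e.
  have /choice[y hy] : forall k, exists y, K y /\ U k = S y.
    by move=> k; have [y] := BU k; exists y.
  have Ky k : K (y k) by case: (hy k).
  have [y' Ky' yy'] := stable_concat sE sK pA Ky.
  have ey := stable_fun_concat sh pA Ky yy'.
  exists y' => //; apply/seteqP; split=> x.
    move=> [z [Uz zx]]; have Sz k : S (y k) (z k) by case: (hy k) => _ <-.
    have Kz k : K (z k) by case: (Sz k).
    split; first by case: sK => _; apply; [exact: pA|exact: Kz|].
    apply: (ae_partition pA) => k; have [_ le] := Sz k.
    ae_use le; ae_use (ey k); apply: filterS (stable_fun_concat sh pA Kz zx k) => w e1 e2 + Aw.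
    by rewrite e1// e2.
  move=> [Kx le].
  have mA k : measurable (A k) by case: pA.
  (* A point [x] above [y'] is the concatenation of points [z k] equal to [x] on [A k] and to [y k]
     elsewhere, and these lie in [S (y k)]. *)
  have /choice[z hz] := fun k => stable_concat2 sE sK (mA k) Kx (Ky k).
  exists z; split=> k; have [Kz e1 e2] := hz k; last by rewrite e1.
  have [_ ->] := hy k; split=> //.
  have c1 := stable_fun_local sh (mA k) Kz Kx e1.
  have c2 := stable_fun_local sh (measurableC (mA k)) Kz (Ky k) e2.
  ae_use le; ae_use c1; ae_use c2; apply: filterS (ey k) => w e3 e4 e5.
  have [Aw|nAw] := pselect (A k w); first by rewrite e3// e5.
  by rewrite e4.
have BK U : B U -> U `<=` K by move=> [y _ ->] z [].
have Bdir U V : B U -> B V -> exists2 W, B W & W `<=` U `&` V.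
  move=> [x Kx ->] [y Ky ->].
  (* [z] follows whichever of [x] and [y] has the larger value of [h], so [S z] lies in both
     sets. *)
  pose A := [set w | rep (h y) w <= rep (h x) w].
  have mA : measurable A by exact: measurable_rep_le.
  have [z [Kz e1 e2]] := stable_concat2 sE sK mA Kx Ky.
  have c1 := stable_fun_local sh mA Kz Kx e1.
  have c2 := stable_fun_local sh (measurableC mA) Kz Ky e2.
  exists (S z); first by exists z.
  have [le1 le2] : le0 (h x) (h z) /\ le0 (h y) (h z).
    split; ae_use c1; apply: filterS c2 => w e3 e4;
      have [Aw|nAw] := pselect (A w); [by rewrite e4| |by rewrite e4|by rewrite e3].
    by rewrite e3// leNgt; apply/negP => lt; apply: nAw; exact: ltW.
  move=> u [Ku le]; split; split=> //.
    by ae_use le; apply: filterS le1 => w; exact: le_trans.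
  by ae_use le; apply: filterS le2 => w; exact: le_trans.
have [x Kx hx] := compact_cluster cK sB BK Bdir.
exists x => // y Ky.
(* A positive radius equal to the gap where [h x < h y]: a point [z] of [S y] with [h z] within [q]
   of [h x] would satisfy [h z < h y] there. *)
have [q hq] : exists q : L, {ae P, forall w, rep q w =
    if rep (h x) w < rep (h y) w then rep (h y) w - rep (h x) w else 1}.
  apply: L0_of_measurable; apply: measurable_fun_ifT.
  - exact: measurable_fun_ltr (measurable_rep _) (measurable_rep _).
  - by apply: measurable_funB; exact: measurable_rep.
  - exact: measurable_cst.
have q0 : pos0 q.
  rewrite /pos0 /lt0; ae_use (@rep0 _ _ _ P); apply: filterS hq => w -> ->.
  by case: ifPn => //; rewrite subr_gt0.
have [V [tO Ox hO]] := ch _ _ Kx q0.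
have [|z [Vz [Kz le]]] := hx _ tO Ox (S y); first by exists y.
rewrite /le0; ae_use le; ae_use (hO _ Vz); apply: filterS hq => w ->.
case: (ltP (rep (h x) w) (rep (h y) w)) => // lt.
rewrite ltr_norml; lra.
Qed.

(** * The uniform metric *)

Section Distance.
Variables (K : set E) (tau : set (set E)).
Hypotheses (sE : stable_module E) (tK : stable_top_space K tau)
  (cK : stable_compact K tau).

Lemma dinf_ub f g x : CK K tau f -> CK K tau g -> K x ->
  {ae P, forall w, `|rep (f x) w - rep (g x) w| <= rep (dinf K f g) w}.
Proof.
move=> cf cg Kx.
pose h z := abs0 (f z - g z).
have hE z := rep_abs0B (f z) (g z).
have sh : stable_fun K h.
  move=> A pA z Kz y zy k; apply/ind_mulP; first by case: pA.
  ae_use (hE y); ae_use (hE (z k)).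
  ae_use (stable_fun_concat cf.1 pA Kz zy k).
  by apply: filterS (stable_fun_concat cg.1 pA Kz zy k) => w e1 e2 -> -> Aw; rewrite e1// e2.
have [sK [[_ [_ [_ [_ tI]]]] _]] := tK.
have [y Ky hy] : exists2 y, K y & forall z, K z -> le0 (h z) (h y).
  apply: (stable_max_attained sE sK cK sh) => z r Kz r0.
  have [q hq] := L0_scale 2^-1 r.
  have q0 : pos0 q.
    by rewrite /pos0 /lt0; ae_use r0; ae_use (@rep0 _ _ _ P); apply: filterS hq => w -> -> ?; lra.
  have [V1 [t1 O1z h1]] := CK_continuous_at cf Kz q0.
  have [V2 [t2 O2z h2]] := CK_continuous_at cg Kz q0.
  exists (V1 `&` V2); split=> //; first exact: tI.
  move=> y [/h1[_ l1] /h2[_ l2]].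
  ae_use l1; ae_use l2; ae_use hq; ae_use (hE y); apply: filterS (hE z) => w -> -> ->.
  move=> l3 l4; apply: le_lt_trans (ler_dist_dist _ _) _.
  have -> : rep (f y) w - rep (g y) w - (rep (f z) w - rep (g z) w) =
    (rep (f y) w - rep (f z) w) - (rep (g y) w - rep (g z) w) by lra.
  apply: le_lt_trans (ler_normB _ _) _; lra.
(* The maximum at [y] makes the defining set of [dinf] nonempty, so [xget] returns a member of it
   and not the default. *)
have := @xgetPex _ 0 [set m | (exists2 x, K x & m = abs0 (f x - g x)) /\
                  forall x, K x -> le0 (abs0 (f x - g x)) m].
rewrite -/(dinf K f g) => -[|_ /(_ _ Kx) le].
  by exists (h y); split=> //; exists y.
by ae_use le; apply: filterS (hE x) => w ->.
Qed.

(** An attained maximum is one of the values bounded by [s]; if [xget] falls back to 0, positivity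
    of [r] gives the claim. *)
Lemma dinf_lt f g s r : pos0 r -> lt0 s r ->
  (forall x, K x -> {ae P, forall w, `|rep (f x) w - rep (g x) w| <= rep s w}) ->
  lt0 (dinf K f g) r.
Proof.
move=> r0 sr h; rewrite /dinf; case: xgetP => [m _ [[x Kx ->] _]|_]; last exact: r0.
rewrite /lt0; ae_use sr; ae_use (h _ Kx); apply: filterS (rep_abs0B (f x) (g x)) => w -> ?.
exact: le_lt_trans.
Qed.

End Distance.
End Module.
End Stable.

(** Induction along an enumeration, joining witnesses by directedness; it yields common bounds and
    common neighbourhoods for finitely many functions or points. *)
Lemma finite_directed (I : eqType) (J : Type) (F : J -> Prop)
    (Q : J -> I -> Prop) (X : set I) :
  finite_set X -> (exists j, F j) ->
  (forall j1 j2, F j1 -> F j2 ->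
     exists2 j, F j & forall i, Q j1 i \/ Q j2 i -> Q j i) ->
  (forall i, X i -> exists2 j, F j & Q j i) ->
  exists2 j, F j & forall i, X i -> Q j i.
Proof.
move=> /finite_seqP[s ->] [j0 F0] dir; elim: s => [|i s IHs] hX.
  by exists j0.
have [|j1 F1 h1] := IHs; first by move=> k ks; apply: hX; rewrite /= inE; apply/orP; right.
have [|j2 F2 h2] := hX i; first by rewrite /= inE eqxx.
have [j Fj hj] := dir _ _ F1 F2; exists j => // k /=.
by rewrite inE => /orP[/eqP ->|ks]; apply: hj; [right|left; exact: h1].
Qed.

(** * Total boundedness implies boundedness and equicontinuity *)

Section TotallyBounded.
Context {R : realType} {d : measure_display} {T : measurableType d}.
Context {P : probability T R}.
Local Notation L := (L0 P).
Variable E : lmodType L.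
Variables (K : set E) (tau : set (set E)) (M : set (E -> L)).
Hypotheses (sE : stable_module E) (tK : stable_top_space K tau)
  (cK : stable_compact K tau) (sM : stable_subset_CK K tau M).

(** An element of a stable finite set is a concatenation of concatenations; on [A k] a second
    partition [B] resolves it into single members of [X k]. *)
Lemma st_pieces (A : nat -> set T) (X : nat -> set (E -> L)) g
    (y : nat -> E -> L) k :
  partition A -> (forall k, st K (X k) (y k)) -> fconcat K A y g ->
  exists (B : nat -> set T) (h : nat -> E -> L),
    [/\ partition B, forall j, X k (h j) & forall j x, K x ->
      {ae P, forall w, A k w -> B j w -> rep (g x) w = rep (h j x) w}].
Proof.
move=> pA sty /(fconcatP _ _ _ pA) yg; have [B [pB [h [Xh /(fconcatP _ _ _ pB) hy]]]] := sty k.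
exists B, h; split=> // j x Kx.
by ae_use (yg k x Kx); apply: filterS (hy j x Kx) => w e1 e2 /e2 -> /e1.
Qed.

Lemma totally_bounded_bounded :
  stable_totally_bounded K M -> L0_pointwise_bounded K M.
Proof.
move=> tb x Kx.
have pos1 : pos0 (1 : L).
  rewrite /pos0 /lt0; ae_use (@rep0 _ _ _ P).
  by apply: filterS (@rep1 _ _ _ P) => w -> ->; exact: ltr01.
have [N [[NM [A [pA [X [hX NE]]]]] MN]] := tb _ pos1.
have /choice[b hb] : forall k, exists b : L, forall h, X k h -> le0 (abs0 (h x)) b.
  move=> k; have [fX _] := hX k.
  have [|||b _ hb] := @finite_directed _ L (fun=> True) (fun b h => le0 (abs0 (h x)) b) _ fX.
  - by exists 0.
  - move=> s t _ _; have [u [su tu]] := L0_upper_bound s t; exists u => // h [] hs.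
      exact: le0_trans hs su.
    exact: le0_trans hs tu.
  - by move=> h _; exists (abs0 (h x)) => //; exact: aeW.
  - by exists b.
have [c hc] := L0_glue b pA.
(* On [A k], [c] bounds the values at [x] of the functions in [X k]; 1 is the radius of the net. *)
exists (c + 1) => f Mf.
have : M f by []; rewrite {1}MN => -[g Ng [_ fg]].
have Mg := NM _ Ng; move: Ng; rewrite NE => -[y [sty yg]].
have [_ [MC _]] := sM.
have le := dinf_ub sE tK cK (MC _ Mf) (MC _ Mg) Kx.
apply: (ae_partition pA) => k.
have [B [h [pB Xh hg]]] := st_pieces k pA sty yg.
apply: (ae_partition pB) => j.
have hbj := hb k _ (Xh j).
ae_use hbj; ae_use (hc k); ae_use (hg j x Kx); ae_use le; ae_use fg.
ae_use (rep_abs0 (f x)); ae_use (rep_abs0 (h j x)); ae_use (repD c 1).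
apply: filterS (@rep1 _ _ _ P) => w -> -> -> -> lt1 le1 e1 e2 + Bw Aw.
move: le1; rewrite e1// e2// => le1 le2.
have := ler_normD (rep (f x) w - rep (h j x) w) (rep (h j x) w).
rewrite subrK; lra.
Qed.

Lemma totally_bounded_equicontinuous :
  stable_totally_bounded K M -> stable_equicontinuous K tau M.
Proof.
move=> tb x Kx r r0; have [_ [MC _]] := sM.
have [sK [[_ [tauK [_ [_ tI]]]] [B [bB [B0 [Bs Bc]]]]]] := tK.
have [q hq] := L0_scale 3^-1 r.
have q0 : pos0 q.
  by rewrite /pos0 /lt0; ae_use r0; ae_use (@rep0 _ _ _ P); apply: filterS hq => w -> -> ?; lra.
have [N [[NM [A [pA [X [hX NE]]]]] MN]] := tb _ q0.
(* Finitely many functions share a neighbourhood of [x]; it is shrunk to a base set so that the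
   concatenation of the [U k] is open. *)
have /choice[U hU] : forall k, exists U, [/\ B U, U x & forall h, X k h ->
    forall y, U y -> K y /\ {ae P, forall w, `|rep (h y) w - rep (h x) w| < rep q w}].
  move=> k; have [fX [_ XM]] := hX k.
  have [|||V [tV Vx] hV] := @finite_directed _ (set E) (fun V => tau V /\ V x)
    (fun V h => forall y, V y ->
      K y /\ {ae P, forall w, `|rep (h y) w - rep (h x) w| < rep q w}) _ fX.
  - by exists K.
  - move=> V W [tV Vx] [tW Wx]; exists (V `&` W); first by split=> //; exact: tI.
    by move=> h [] hV y [Vy Wy]; exact: hV.
  - move=> h /XM/MC ch; have [V [tV Vx hV]] := CK_continuous_at ch Kx q0.
    by exists V.
  - have [U [BU Ux UV]] := base_nbhd bB tV Vx.
    by exists U; split=> // h Xh y /UV; exact: hV.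
have UK k y : U k y -> K y.
  by have [_ [[h Xh] _]] := hX k; have [_ _ /(_ _ Xh) hk /hk[]] := hU k.
exists (concat_set A U); split.
  split.
    by move=> y [z [Uz zy]]; case: sK => _; apply; [exact: pA|move=> k; exact: UK (Uz k)|].
  exists (concat_set A U); split; first by apply: bB.1; apply: Bc => // k; case: (hU k).
  by split=> //; apply: concat_set_const => k; case: (hU k).
move=> y f [z [Uz zy]] Mf.
have Kz k : K (z k) := UK _ _ (Uz k).
have Ky : K y by case: sK => _; apply; [exact: pA|exact: Kz|].
have : M f by []; rewrite {1}MN => -[g Ng [_ fg]].
have Mg := NM _ Ng; move: Ng; rewrite NE => -[gk [sty yg]].
have lex := dinf_ub sE tK cK (MC _ Mf) (MC _ Mg) Kx.
have ley := dinf_ub sE tK cK (MC _ Mf) (MC _ Mg) Ky.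
apply: (ae_partition pA) => k.
have [C [h [pC Xh hg]]] := st_pieces k pA sty yg.
apply: (ae_partition pC) => j.
have [_ _ /(_ _ (Xh j) _ (Uz k))[_ lt]] := hU k.
have [_ [_ XM]] := hX k.
(* On [A k] the function [h j] has the same values at [y] and at [z k], and [z k] lies in the
   neighbourhood [U k] adapted to [h j]. *)
have ez := stable_fun_concat (MC _ (XM _ (Xh j))).1 pA Kz zy k.
ae_use lt; ae_use ez; ae_use (hg j x Kx); ae_use (hg j y Ky); ae_use lex; ae_use ley.
ae_use fg; ae_use hq; apply: filterS (rep_abs0B (f x) (f y)) => w -> -> l1 l2 l3 e1 e2 e3 l4 Cw Aw.
move: l2 l3 l4; rewrite e1// e2// -e3//.
rewrite distrC => l2 l3 l4.
have -> : rep (f x) w - rep (f y) w = (rep (f x) w - rep (h j x) w)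
  - (rep (h j y) w - rep (h j x) w) + (rep (h j y) w - rep (f y) w) by lra.
apply: le_trans (ler_normD _ _) _.
have := ler_normB (rep (f x) w - rep (h j x) w) (rep (h j y) w - rep (h j x) w).
lra.
Qed.

End TotallyBounded.

(** * Covering [K] by locally finitely many points *)

Section Covering.
Context {R : realType} {d : measure_display} {T : measurableType d}.
Context {P : probability T R}.
Local Notation L := (L0 P).
Local Notation null C := {ae P, forall w, ~ C w}.
Variable E : lmodType L.
Variables (K : set E) (tau : set (set E)) (M : set (E -> L)).
Implicit Types (A C D : set T) (x y z : E) (X : set E) (r : L).

Definition close r x y D := forall f, M f ->
  {ae P, forall w, D w -> `|rep (f x) w - rep (f y) w| <= rep r w}.

(** A hereditary negation of [close]: closeness fails on every nonnull part of [C]. Unlike mere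
    failure on [C], this passes to parts and can be glued along partitions. *)
Definition far r x y C := forall D, measurable D -> D `<=` C ->
  close r x y D -> null D.

(* By exhaustion, this says that every [y] in [K] is, on [C], [r]-close to a
   concatenation of points of [X]. *)
Definition covers r X C := forall y D, K y -> measurable D -> D `<=` C ->
  ~ null D -> exists x D',
    [/\ X x, measurable D', D' `<=` D, ~ null D' & close r x y D'].

Lemma close_subset r x y C D : C `<=` D -> close r x y D -> close r x y C.
Proof. by move=> CD h f Mf; apply: filterS (h f Mf) => w + /CD. Qed.

Lemma far_subset r x y C D : C `<=` D -> far r x y D -> far r x y C.
Proof. by move=> CD h D' mD' D'C; apply: h => // w /D'C/CD. Qed.

Lemma null_far r x y C : null C -> far r x y C.
Proof. by move=> nC D _ DC _; exact: null_subset DC nC. Qed.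

Lemma far_partition r x y C (A : nat -> set T) : partition A ->
  (forall k, far r x y (C `&` A k)) -> far r x y C.
Proof.
move=> pA h D mD DC cD; apply: (ae_partition pA) => k.
have : null (D `&` A k).
  apply: (h k); first by apply: measurableI => //; case: pA.
    by move=> w [/DC Cw Aw]; split.
  by apply: close_subset cD => w [].
by apply: filterS => w nDA Aw Dw; apply: nDA.
Qed.

Lemma covers_subset r X C D : D `<=` C -> covers r X C -> covers r X D.
Proof. by move=> DC h y D' Ky mD' D'D; apply: h => // w /D'D/DC. Qed.

Hypotheses (sE : stable_module E) (tK : stable_top_space K tau)
  (cK : stable_compact K tau) (sM : stable_subset_CK K tau M).

Lemma far_local r x x' y y' A C : measurable A ->
  K x -> K x' -> K y -> K y' ->
  ind A *: x = ind A *: x' -> ind A *: y = ind A *: y' ->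
  far r x y (C `&` A) -> far r x' y' (C `&` A).
Proof.
move=> mA Kx Kx' Ky Ky' ex ey h D mD DCA cD; apply: h => // f Mf.
have [_ [MC _]] := sM; have [sf _] := MC _ Mf.
ae_use (cD f Mf); ae_use (stable_fun_local sf mA Kx Kx' ex).
apply: filterS (stable_fun_local sf mA Ky Ky' ey) => w e1 e2 le Dw.
by have [_ Aw] := DCA _ Dw; rewrite e1// e2//; exact: le.
Qed.

Section NonCoverable.
Variables (r : L) (B : set T).
Hypotheses (mB : measurable B)
  (nB : forall D, measurable D -> D `<=` B -> ~ null D ->
          forall X, finite_set X -> X `<=` K -> ~ covers r X D).

(* The sequence [x] restricted to the indices [i] with [w] in [D i] stands for
   a finite set of points depending measurably on [w]. *)
Definition finite_index (D : nat -> set T) :=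
  (forall i, measurable (D i)) /\
  forall w, exists n, forall i, (n <= i)%N -> ~ D i w.

Definition far_set (x : nat -> E) (D : nat -> set T) :=
  [set y | K y /\ forall i, far r (x i) y (B `&` D i)].

Lemma far_set_nonempty (x : nat -> E) (D : nat -> set T) :
  (forall i, K (x i)) -> finite_index D -> far_set x D !=set0.
Proof.
move=> Kx [mD fD]; have [sK _] := tK.
pose Phi C := exists2 y, K y & forall i, far r (x i) y (B `&` D i `&` C).
have [||C mC nC|A [pA PA]] := @exhaustion_partition _ _ _ P Phi.
- move=> C C' [y Ky h] _ C'C; exists y => // i.
  by apply: far_subset (h i) => w [? /C'C].
- move=> C _ nC; exists (x 0%N) => // i; apply: null_far.
  by apply: null_subset nC => w [].
(* On [G n] only indices below [n] are active, so there the sequence amounts to the finite set of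
   [x i] with [i < n]. *)
- pose G n := \bigcap_(i in [set i | (n <= i)%N]) ~` D i.
  have mG n : measurable (G n).
    by apply: bigcap_measurableType => i _; exact: measurableC.
  have [n nCn] : exists n, ~ null (C `&` G n).
    apply: contrapT => h; apply: nC.
    have /ae_foralln : forall n, null (C `&` G n).
      by move=> n; apply: contrapT => h'; apply: h; exists n.
    apply: filterS => w hw Cw; have [n hn] := fD w.
    by apply: (hw n); split=> // i; exact: hn.
  have mCG : measurable (C `&` G n) by exact: measurableI.
  have [nBC|nBC] := pselect (null (B `&` (C `&` G n))).
    exists (C `&` G n); split=> //; exists (x 0%N) => // i; apply: null_far.
    by apply: null_subset nBC => w [[]].
  have mBC : measurable (B `&` (C `&` G n)) by exact: measurableI.
  have BCB : B `&` (C `&` G n) `<=` B by move=> w [].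
  have fX : finite_set [set x i | i in `I_n] by apply: finite_image; exact: finite_II.
  have XK : [set x i | i in `I_n] `<=` K by move=> _ [i _ <-].
  (* As these points do not cover, there are [y] and a nonnull [D0] such that [y] is close to none
     of them on any nonnull part of [D0]. *)
  have := nB mBC BCB nBC fX XK; rewrite /covers.
  move=> /existsNP[y /existsNP[D0]] /not_implyP[Ky] /not_implyP[mD0]
    /not_implyP[D0s] /not_implyP[nD0 hy].
  exists D0; split=> //; first by move=> w /D0s[_ []].
  exists y => // i; have [ltin|leni] := ltnP i n.
    move=> D' mD' D's cD'; apply: contrapT => nD'; apply: hy.
    exists (x i), D'; split=> //; first by exists i.
    by move=> w /D's[].
  apply: null_far; apply: aeW => w [[_ Dw] /D0s[_ [_ Gw]]].
  exact: (Gw i).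
have /choice[y hy] : forall k, exists y, K y /\ forall i, far r (x i) y (B `&` D i `&` A k).
  by move=> k; have [y] := PA k; exists y.
have Ky k : K (y k) by case: (hy k).
have [z Kz yz] := stable_concat sE sK pA Ky.
exists z; split=> // i; apply: (far_partition pA) => k; have [_ /(_ i)] := hy k.
by apply: far_local => //; case: pA.
Qed.

(** Sequences with activity sets replace finite sets: the number of active points may vary with [w]
    without bound, as closure under concatenation requires. *)
Definition far_base :=
  [set U | exists (x : nat -> E) (D : nat -> set T),
    [/\ forall i, K (x i), finite_index D & U = far_set x D]].

Lemma far_base_stable : stable_collection far_base.
Proof.
have [sK _] := tK.
have [x0 Kx0] : K !=set0 by case: sK.
split.
  exists (far_set (fun=> x0) (fun=> set0)); exists (fun=> x0), (fun=> set0).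
  by split=> //; split=> [i|w]; [exact: measurable0|exists 0%N => i _ []].
split=> [_ [x [D [Kx fD ->]]]|A pA U BU].
  split; first exact: far_set_nonempty.
  move=> A pA z Sz y zy; have Kz k : K (z k) by case: (Sz k).
  have Ky : K y by case: sK => _; apply; [exact: pA|exact: Kz|].
  split=> // i; apply: (far_partition pA) => k.
  apply: (@far_local _ (x i) _ (z k)) => //; first by case: pA.
  by case: (Sz k) => _ /(_ i); apply: far_subset => w [].
have /choice[x /choice[D hU]] : forall k, exists (x : nat -> E) (D : nat -> set T),
    [/\ forall i, K (x i), finite_index D & U k = far_set x D] by [].
have Kx k i : K (x k i) by case: (hU k).
have fD k : finite_index (D k) by case: (hU k).
have mA k : measurable (A k) by case: pA.
have /choice[x' hx'] : forall i, exists y, K y /\ is_concat A (x ^~ i) y.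
  move=> i; have [|y] := @stable_concat _ _ _ _ _ K A (x ^~ i) sE sK pA; last by exists y.
  by move=> k; exact: Kx.
have Kx' i : K (x' i) by case: (hx' i).
(* Points are glued index by index, and [x' i] is active on [A k] exactly where [x k i] is. *)
pose D' i := \bigcup_k (A k `&` D k i).
have D'A k i : D' i `&` A k `<=` D k i.
  move=> w [[j _ [Aj Dj]] Ak]; case: pA => _ [tA _].
  by rewrite (tA k j)//; exists w.
have AD' k i : D k i `&` A k `<=` D' i by move=> w [Dk Ak]; exists k.
exists x', D'; split=> //.
  split.
    by move=> i; apply: bigcup_measurable => k _; apply: measurableI => //; case: (fD k).
  move=> w; have [k Ak] := partition_index pA w; have [_ /(_ w)[n hn]] := fD k.
  by exists n => i ni Di; apply: (hn i ni); exact: D'A.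
apply/seteqP; split=> z.
  move=> [y [Uy yz]].
  have Sy k : far_set (x k) (D k) (y k) by case: (hU k) => _ _ <-.
  have Ky k : K (y k) by case: (Sy k).
  have Kz : K z by case: sK => _; apply; [exact: pA|exact: Ky|].
  split=> // i; apply: (far_partition pA) => k.
  apply: (@far_local _ (x k i) _ (y k)) => //; first by case: (hx' i) => _ ->.
  case: (Sy k) => _ /(_ i); apply: far_subset => w [[Bw D'w] Aw]; split=> //.
  exact: D'A.
move=> [Kz hz].
(* Off [A k] the point [z] need not be far from the [k]-th family; there it is replaced by a point
   [u k] of the [k]-th far set. *)
have /choice[u hu] k : far_set (x k) (D k) !=set0 by exact: far_set_nonempty.
have Ku k : K (u k) by case: (hu k).
have /choice[y hy] := fun k => stable_concat2 sE sK (mA k) Kz (Ku k).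
exists y; split=> k; have [Ky e1 e2] := hy k; last by rewrite e1.
have [_ _ ->] := hU k; split=> // i.
apply: (far_partition (partition_bipart (mA k))) => -[|[|j]] /=.
- apply: (@far_local _ (x' i) _ z) => //; first by case: (hx' i) => _ ->.
  apply: far_subset (hz i) => w [[Bw Dw] Aw]; split=> //.
  by apply: (AD' k); split.
- apply: (@far_local _ (x k i) _ (u k)) => //; first exact: measurableC.
  by case: (hu k) => _ /(_ i); apply: far_subset => w [].
- by apply: null_far; apply: aeW => w [].
Qed.

Lemma far_base_directed U V : far_base U -> far_base V ->
  exists2 W, far_base W & W `<=` U `&` V.
Proof.
move=> [x [D [Kx [mD fD] ->]]] [y [C [Ky [mC fC] ->]]].
(* Interleaving: even indices carry the first family, odd ones the second. Halving explains the
   bound [(maxn n m).*2] from which on no index is active. *)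
pose z i := if odd i then y i./2 else x i./2.
pose F i := if odd i then C i./2 else D i./2.
exists (far_set z F).
  exists z, F; split=> //; first by move=> i; rewrite /z; case: odd.
  split=> [i|w]; first by rewrite /F; case: odd.
  have [[n hn] [m hm]] := (fD w, fC w); exists (maxn n m).*2 => i.
  move=> /half_leq; rewrite doubleK geq_max => /andP[ni mi].
  by rewrite /F; case: odd; [exact: hm|exact: hn].
move=> u [Ku hu]; split; split=> // i.
  by have := hu i.*2; rewrite /z /F odd_double doubleK.
by have := hu i.*2.+1; rewrite /z /F /= odd_double /= uphalf_double.
Qed.

End NonCoverable.

Lemma equicontinuous_cover r : pos0 r -> stable_equicontinuous K tau M ->
  exists (A : nat -> set T) (X : nat -> set E), partition A /\
    forall k, [/\ finite_set (X k), X k `<=` K & covers r (X k) (A k)].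
Proof.
move=> r0 eqM.
pose Phi C := exists X, [/\ finite_set X, X `<=` K & covers r X C].
have [||B mB nB|A [pA /choice[X hX]]] := @exhaustion_partition _ _ _ P Phi; last by exists A, X.
- by move=> A C [X [fX XK cX]] _ CA; exists X; split=> //; exact: covers_subset cX.
- move=> C _ nC; exists set0; split=> // y D _ _ DC nD; exfalso; apply: nD.
  exact: null_subset nC.
apply: contrapT => hB.
have {}hB D : measurable D -> D `<=` B -> ~ null D ->
    forall X, finite_set X -> X `<=` K -> ~ covers r X D.
  by move=> mD DB nD X fX XK cX; apply: hB; exists D; split=> //; exists X.
have [||x Kx hx] := compact_cluster cK (far_base_stable mB hB).
- by move=> _ [x [D [_ _ ->]]] y [].
- exact: far_base_directed.
have [V [[VK [V' [tV' [V'x V'V]]]] hV]] := eqM _ Kx _ r0.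
(* Only index 0 is active, so the far set asks for points far on [B] from the single point [x]. *)
pose D i := if i is 0%N then [set: T] else set0.
have [|y [/V'V Vy [Ky far]]] := hx _ tV' V'x (far_set r B (fun=> x) D).
  exists (fun=> x), D; split=> //; split=> [[|i]|w]; [exact: measurableT|exact: measurable0|].
  by exists 1%N => -[|i] // _ [].
(* Equicontinuity makes [y] close to [x] on all of [B], yet [y] is far from [x] on [B]; this forces
   [B] to be null. *)
apply: nB; apply: (far 0%N) => //.
move=> f Mf; ae_use (hV _ _ Vy Mf).
by apply: filterS (rep_abs0B (f x) (f y)) => w ->.
Qed.

End Covering.

(** * Finite nets on small pieces, by coding values on a grid *)

Section Net.
Context {R : realType} {d : measure_display} {T : measurableType d}.
Context {P : probability T R}.
Local Notation L := (L0 P).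
Local Notation null C := {ae P, forall w, ~ C w}.
Variable E : lmodType L.
Variables (K : set E) (tau : set (set E)) (M : set (E -> L)).
Implicit Types (A C D : set T) (x y z : E) (f g : E -> L) (q r : L).
Hypotheses (tK : stable_top_space K tau) (sM : stable_subset_CK K tau M).

Lemma stable_subset_fconcat (A : nat -> set T) (g : nat -> E -> L) f :
  partition A -> (forall k, M (g k)) -> fconcat K A g f -> M f.
Proof.
have [_ [MC Mc]] := sM; move=> pA Mg gf; apply: (Mc A pA g) => //.
by apply: CK_fconcat gf => // k; exact: MC.
Qed.

(** The factor 4 collects two errors [q] from moving between [y] and a covering point, and two from
    rounding values there to a grid of mesh at most [q]. *)
Definition uclose q f g D := forall y, K y ->
  {ae P, forall w, D w -> `|rep (f y) w - rep (g y) w| <= 4 * rep q w}.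

Definition nets q (Y : set (E -> L)) C := forall f D, M f -> measurable D ->
  D `<=` C -> ~ null D -> exists g D',
    [/\ Y g, measurable D', D' `<=` D, ~ null D' & uclose q f g D'].

Lemma nonnull_bigcup C (D : nat -> set T) :
  {ae P, forall w, C w -> exists n, D n w} -> ~ null C ->
  exists n, ~ null (C `&` D n).
Proof.
move=> CD nC; apply: contrapT => h; apply: nC; ae_use CD.
have /ae_foralln : forall n, null (C `&` D n).
  by move=> n; apply: contrapT => h'; apply: h; exists n.
by apply: filterS => w hw h' Cw; have [n Dn] := h' Cw; apply: (hw n).
Qed.

(** A random bound and a random radius become the real constants [n] and [1/(n+1)], so that a finite
    grid suffices. *)
Lemma local_constants (b q : L) C : pos0 q -> measurable C -> ~ null C ->
  exists n D, [/\ measurable D, D `<=` C, ~ null D &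
    forall w, D w -> rep b w < n%:R /\ n.+1%:R^-1 < rep q w].
Proof.
move=> q0 mC nC.
pose D n := [set w | rep b w < n%:R /\ n.+1%:R^-1 < rep q w].
have mD n : measurable (D n).
  have m1 : measurable [set w | rep b w < n%:R].
    have := measurable_fun_ltr (measurable_rep b) (measurable_cst (n%:R : R))
      measurableT (Y := [set true]).
    by rewrite setTI; exact.
  have m2 : measurable [set w | n.+1%:R^-1 < rep q w].
    have := measurable_fun_ltr (measurable_cst (n.+1%:R^-1 : R)) (measurable_rep q)
      measurableT (Y := [set true]).
    by rewrite setTI; exact.
  exact: measurableI m1 m2.
have [|n nD] := nonnull_bigcup (D := D) _ nC.
  ae_use q0; apply: filterS (@rep0 _ _ _ P) => w -> qw _.
  have [k hk] := ltr_add_invr qw; rewrite add0r in hk.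
  pose n := maxn k (Num.trunc (rep b w)).+1; exists n; split.
    apply: lt_le_trans (truncnS_gt _) _.
    by rewrite ler_nat leq_maxr.
  apply: le_lt_trans hk; rewrite lef_pV2 ?posrE ?ltr0n// ler_nat ltnS.
  exact: leq_maxl.
exists n, (C `&` D n); split=> //; first exact: measurableI.
by move=> w [].
Qed.

(** [v i] counts the steps of length [delta] from [-n] to a grid point approximating the value at
    [p i]. *)
Definition coded (m N : nat) (n : R) (delta : R) (p : 'I_m -> E)
    (v : {ffun 'I_m -> 'I_N}) f D :=
  forall i, {ae P, forall w, D w ->
    `|rep (f (p i)) w - ((v i)%:R * delta - n)| <= delta}.

Lemma grid_code (m n : nat) (delta : R) : 0 < delta ->
  exists N : nat, forall u : 'I_m -> R, (forall i, `|u i| <= n%:R) ->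
    exists v : {ffun 'I_m -> 'I_N.+1}, forall i,
      `|u i - ((v i)%:R * delta - n%:R)| <= delta.
Proof.
(* The number of whole steps in an interval of length [2n]; rounding down gives indices from 0 to
   [N]. *)
move=> d0; pose N := Num.trunc ((n%:R + n%:R) / delta).
exists N => u hu.
have e i : (Num.trunc ((u i + n%:R) / delta) < N.+1)%N.
  rewrite ltnS; apply: le_truncn; rewrite ler_pM2r ?invr_gt0//.
  by have := hu i; rewrite ler_norml; lra.
exists [ffun i => Ordinal (e i)] => i; rewrite ffunE /=.
have ge0 : 0 <= (u i + n%:R) / delta.
  by rewrite divr_ge0 ?(ltW d0)//; have := hu i; rewrite ler_norml; lra.
have := truncn_itv ge0; set k := Num.trunc _.
rewrite ler_pdivlMr// ltr_pdivrMr// -natr1 mulrDl mul1r => /andP[h1 h2].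
rewrite ler_norml; lra.
Qed.

(** The sets [F v] where [v] is a valid code are finitely many and cover [D] up to a null set, so
    one of them is nonnull. *)
Lemma coded_local (m N : nat) (n delta : R) (p : 'I_m -> E) f D :
  measurable D -> ~ null D ->
  {ae P, forall w, D w -> exists v : {ffun 'I_m -> 'I_N}, forall i,
    `|rep (f (p i)) w - ((v i)%:R * delta - n)| <= delta} ->
  exists (v : {ffun 'I_m -> 'I_N}) D',
    [/\ measurable D', D' `<=` D, ~ null D' & coded n delta p v f D'].
Proof.
move=> mD nD h.
pose F (v : {ffun 'I_m -> 'I_N}) := D `&` \bigcap_(i in setT)
  [set w | `|rep (f (p i)) w - ((v i)%:R * delta - n)| <= delta].
have mF v : measurable (F v).
  apply: measurableI => //; apply: fin_bigcap_measurable; first exact: finite_finset.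
  move=> i _.
  have m1 : measurable_fun setT (fun w => `|rep (f (p i)) w - ((v i)%:R * delta - n)|).
    apply: measurableT_comp => //; apply: measurable_funB; first exact: measurable_rep.
    exact: measurable_cst.
  have := measurable_fun_ler m1 (measurable_cst delta) measurableT (Y := [set true]).
  by rewrite setTI; exact.
have [v nv] : exists v, ~ null (F v).
  apply: contrapT => nF; apply: nD; ae_use h.
  have : {ae P, forall w, forall v, ~ F v w}.
    apply: filter_forall => v; apply: contrapT => nv; apply: nF; by exists v.
  by apply: filterS => w nFw hw Dw; have [v hv] := hw Dw; apply: (nFw v);
    split=> // i _; exact: hv.
exists v, (F v); split=> //; first by move=> w [].
by move=> i; apply: aeW => w [_ /(_ i)]; apply.
Qed.

Lemma local_net q (X : set E) C : pos0 q -> L0_pointwise_bounded K M ->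
  finite_set X -> X `<=` K -> covers K M q X C -> measurable C -> ~ null C ->
  exists D, [/\ measurable D, D `<=` C, ~ null D &
    exists Y, [/\ finite_set Y, Y !=set0, Y `<=` M & nets q Y D]].
Proof.
move=> q0 bM fX XK cX mC nC; have [[g0 Mg0] [MC _]] := sM.
have [b hb] : exists b : L, forall x, X x -> forall f, M f -> le0 (abs0 (f x)) b.
  have [|||b _ hb] := @finite_directed _ L (fun=> True)
    (fun b x => forall f, M f -> le0 (abs0 (f x)) b) _ fX.
  - by exists 0.
  - move=> s t _ _; have [u [su tu]] := L0_upper_bound s t; exists u => // x [] hs f Mf.
      exact: le0_trans (hs f Mf) su.
    exact: le0_trans (hs f Mf) tu.
  - by move=> x /XK/bM[b hb]; exists b.
  - by exists b.
have [n [D [mD DC nD hD]]] := local_constants b q0 mC nC.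
exists D; split=> //.
move/finite_seqP: fX => [s XE].
pose m := size s; pose p (i : 'I_m) := nth 0 s i.
have Xp i : X (p i) by rewrite XE /= mem_nth.
pose delta : R := n.+1%:R^-1.
have d0 : 0 < delta by rewrite invr_gt0 ltr0n.
have [N hN] := grid_code m n d0.
pose cd := @coded m N.+1 n%:R delta p.
(* [G v] realizes the code [v] wherever some element of [M] does: exhaustion collects these places,
   and [g0] fills the leftover [A 0], which a.e. misses every measurable set on which a function of
   [M] has code [v]. *)
have /choice[G hG] : forall v, exists g, M g /\ forall f D', M f ->
    measurable D' -> cd v f D' -> cd v g D'.
  move=> v; pose Phi D' := exists2 g, M g & cd v g D'.
  have [A C' [g Mg cg] _ C'A|//|A [pA PA maxA]] := @exhaustion _ _ _ P Phi.
  - by exists g => // i; apply: filterS (cg i) => w + /C'A.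
  - by exists g0 => // i; exact: aeW.
  have /choice[h hh] : forall k, exists g, M g /\ cd v g (A k.+1).
    by move=> k; have [g] := PA k; exists g.
  pose h' k := if k is k'.+1 then h k' else g0.
  have Mh' k : M (h' k) by case: k => //= k; case: (hh k).
  have [g hg] := fconcat_exists K h' pA.
  exists g; split; first exact: stable_subset_fconcat hg.
  move=> f D' Mf mD' cf i.
  have Kp : K (p i) := XK _ (Xp i).
  have max : {ae P, forall w, D' w -> ~ A 0%N w} by apply: maxA => //; exists f.
  ae_use max; apply: (ae_partition pA) => -[|k]; first by apply: aeW => w Aw h1 /h1.
  move/(fconcatP _ _ _ pA): hg => /(_ k.+1 _ Kp) e.
  ae_use e; case: (hh k) => _ /(_ i); apply: filterS => w le e1 Aw _ _.
  by rewrite e1//; exact: le.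
exists (range G); split.
- by apply: finite_image; exact: finite_finset.
- by exists (G [ffun=> ord0]).
- by move=> _ [v _ <-]; case: (hG v).
move=> f D1 Mf mD1 D1D nD1.
have [|v [D' [mD' D'D1 nD' cf]]] := @coded_local m N.+1 n%:R delta p f D1 mD1 nD1.
  have : {ae P, forall w, forall i, rep (abs0 (f (p i))) w <= rep b w}.
    by apply: filter_forall => i; exact: hb.
  have : {ae P, forall w, forall i, rep (abs0 (f (p i))) w = `|rep (f (p i)) w|}.
    by apply: filter_forall => i; exact: rep_abs0.
  apply: filterS2 => w e le Dw; apply: hN => i; rewrite -e.
  by apply: le_trans (le i) _; have [/ltW] := hD _ (D1D _ Dw).
have [MG /(_ f D' Mf mD' cf) cG] := hG v.
exists (G v), D'; split=> // y Ky.
have [q4 hq4] := L0_scale 4 q.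
(* [Z] is where the estimate fails at [y]. Were it nonnull, some [x] in [X] would be close to [y] on
   a nonnull part, for [f] and [G v] alike, and their common code at [x] would give the estimate
   there. *)
pose Z := D' `&` [set w | rep q4 w < rep (abs0 (f y - G v y)) w].
have mZ : measurable Z by apply: measurableI => //; exact: measurable_rep_lt.
suff nZ : null Z.
  ae_use nZ; ae_use hq4; apply: filterS (rep_abs0B (f y) (G v y)) => w e e4 nZw D'w.
  by rewrite leNgt; apply/negP => lt; apply: nZw; split=> //=; rewrite e e4.
apply: contrapT => nZ.
have ZC : Z `<=` C by move=> w [/D'D1/D1D/DC].
have [x [Z' [Xx mZ' Z'Z nZ' cl]]] := cX y Z Ky mZ ZC nZ.
move: (Xx); rewrite XE /= => xs.
have ltx : (index x s < m)%N by rewrite index_mem.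
have xE : x = p (Ordinal ltx) by rewrite /p /= nth_index.
apply: nZ'; ae_use hq4; ae_use (rep_abs0B (f y) (G v y)); ae_use (cl f Mf).
ae_use (cl _ MG); ae_use (cf (Ordinal ltx)).
apply: filterS (cG (Ordinal ltx)) => w + + + + e e4 /[dup] /Z'Z[D'w /= lt] Z'w.
move=> /(_ D'w) l1 /(_ D'w) l2 /(_ Z'w) l3 /(_ Z'w) l4.
move: lt; rewrite e e4; apply/negP; rewrite -leNgt.
have [_ /ltW] := hD _ (D1D _ (D'D1 _ D'w)); rewrite -/delta => dq.
rewrite -xE in l1 l2; move: l1 l2 l3 l4 dq.
set a1 := rep (f y) w; set a2 := rep (G v y) w; set a3 := rep (f x) w.
set a4 := rep (G v x) w; set c := _ * _ - _; rewrite !ler_norml; lra.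
Qed.

End Net.

(** * Gluing the local nets, and the equivalence *)

Section ArzelaAscoli.
Context {R : realType} {d : measure_display} {T : measurableType d}.
Context {P : probability T R}.
Local Notation L := (L0 P).
Local Notation null C := {ae P, forall w, ~ C w}.
Variable E : lmodType L.
Variables (K : set E) (tau : set (set E)) (M : set (E -> L)).
Hypotheses (sE : stable_module E) (tK : stable_top_space K tau)
  (cK : stable_compact K tau) (sM : stable_subset_CK K tau M).

Lemma net_partition (q : L) : pos0 q -> L0_pointwise_bounded K M ->
  stable_equicontinuous K tau M ->
  exists (C : nat -> set T) (Y : nat -> set (E -> L)), partition C /\
    forall k, [/\ finite_set (Y k), Y k !=set0, Y k `<=` M & nets K M q (Y k) (C k)].
Proof.
move=> q0 bM eM; have [[g0 Mg0] _] := sM.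
have [A [X [pA hX]]] := equicontinuous_cover sE tK cK sM q0 eM.
pose Phi C := exists Y, [/\ finite_set Y, Y !=set0, Y `<=` M & nets K M q Y C].
have [||C mC nC|C [pC /choice[Y hY]]] := @exhaustion_partition _ _ _ P Phi; last by exists C, Y.
- move=> C D [Y [fY Y0 YM nY]] _ DC; exists Y; split=> // f D' Mf mD' D'D.
  by apply: nY => // w /D'D/DC.
- move=> C _ nC; exists [set g0]; split=> //; first by exists g0.
    by move=> _ ->.
  move=> f D _ _ DC nD; exfalso; apply: nD; exact: null_subset nC.
have [|k nCk] := nonnull_bigcup (D := A) _ nC.
  by apply: aeW => w _; exact: partition_index.
have mCk : measurable (C `&` A k) by apply: measurableI => //; case: pA.
have [fX XK cX] := hX k.
have CA : C `&` A k `<=` A k by move=> w [].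
have [D [mD DC nD hD]] := local_net tK sM q0 bM fX XK (covers_subset CA cX) mCk nCk.
by exists D; split=> // w /DC[].
Qed.

(** Exhaustion runs over the whole space with errors measured on [C] only, because an element of
    [st K Y] needs a partition of the whole space. *)
Lemma net_approximation (q : L) (C : set T) (Y : set (E -> L)) (f : E -> L) :
  measurable C -> Y !=set0 -> nets K M q Y C -> M f ->
  exists2 g, st K Y g & uclose K q f g C.
Proof.
move=> mC [y0 Yy0] nY Mf.
pose Phi D := exists2 g, Y g & uclose K q f g (C `&` D).
have [||D mD nD|D [pD PD]] := @exhaustion_partition _ _ _ P Phi.
- move=> A D [g Yg h] _ DA; exists g => // x Kx.
  by apply: filterS (h x Kx) => w + [Cw /DA Aw]; apply.
- move=> D _ nD; exists y0 => // x Kx; apply: filterS nD => w nDw [_ Dw].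
  by case: (nDw Dw).
- have [nCD|nCD] := pselect (null (C `&` D)).
    exists D; split=> //; exists y0 => // x Kx; apply: filterS nCD => w h CDw.
    by case: (h CDw).
  have mCD : measurable (C `&` D) by exact: measurableI.
  have CDC : C `&` D `<=` C by move=> w [].
  have [g [D' [Yg mD' D'D nD' h]]] := nY f _ Mf mCD CDC nCD.
  exists D'; split=> //; first by move=> w /D'D[].
  by exists g => // x Kx; apply: filterS (h x Kx) => w + [_ Dw]; apply.
have /choice[h hh] : forall j, exists g, Y g /\ uclose K q f g (C `&` D j).
  by move=> j; have [g] := PD j; exists g.
have [g hg] := fconcat_exists K h pD.
exists g.
  by exists D; split=> //; exists h; split=> // j; case: (hh j).
move=> x Kx; apply: (ae_partition pD) => j.
move/(fconcatP _ _ _ pD): hg => /(_ j x Kx) e; case: (hh j) => _ /(_ x Kx) le.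
ae_use e; apply: filterS le => w le e1 Dw Cw.
by rewrite e1//; apply: le.
Qed.

Lemma equicontinuous_totally_bounded : L0_pointwise_bounded K M ->
  stable_equicontinuous K tau M -> stable_totally_bounded K M.
Proof.
move=> bM eM r r0.
(* The net error [4 * q] then equals [r / 2], strictly below [r]. *)
have [q hq] := L0_scale 8^-1 r.
have q0 : pos0 q.
  by rewrite /pos0 /lt0; ae_use r0; ae_use (@rep0 _ _ _ P); apply: filterS hq => w -> -> ?; lra.
have [C [Y [pC hY]]] := net_partition q0 bM eM.
pose N : set (E -> L) := [set f | exists y : nat -> E -> L,
  (forall k, st K (Y k) (y k)) /\ fconcat K C y f].
have NM : N `<=` M.
  move=> f [y [sty yf]]; apply: (stable_subset_fconcat tK sM pC) yf => k.
  have [B [pB [h [Yh hy]]]] := sty k; have [_ _ YM _] := hY k.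
  by apply: (stable_subset_fconcat tK sM pB) hy => j; exact: YM.
exists N; split.
  split=> //; exists C; split=> //; exists Y; split=> // k.
  by have [fY Y0 YM _] := hY k.
apply/seteqP; split=> [f Mf|f [g _ []]//].
have /choice[y hy] : forall k, exists g, st K (Y k) g /\ uclose K q f g (C k).
  move=> k; have [_ Y0 _ nY] := hY k.
  have mC : measurable (C k) by case: pC.
  by have [g] := net_approximation mC Y0 nY Mf; exists g.
have [g hg] := fconcat_exists K y pC.
exists g; first by exists y; split=> // k; case: (hy k).
split=> //; have [q4 hq4] := L0_scale 4 q.
apply: (dinf_lt r0 (s := q4)).
  rewrite /lt0; ae_use r0; ae_use (@rep0 _ _ _ P); ae_use hq4.
  apply: filterS hq => w -> -> -> ?; lra.
move=> x Kx; apply: (ae_partition pC) => k.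
move/(fconcatP _ _ _ pC): hg => /(_ k x Kx) e; case: (hy k) => _ /(_ x Kx) le.
ae_use e; ae_use hq4; apply: filterS le => w le -> e1 Cw.
by rewrite e1//; apply: le.
Qed.

End ArzelaAscoli.

Theorem theorem6 (R : realType) (d : measure_display) (T : measurableType d)
    (P : probability T R) (E : lmodType (L0 P))
    (K : set E) (tau : set (set E)) (M : set (E -> L0 P)) :
  stable_module E ->
  stable_top_space K tau ->
  stable_compact K tau ->
  stable_subset_CK K tau M ->
  (stable_totally_bounded K M <->
   L0_pointwise_bounded K M /\ stable_equicontinuous K tau M).
Proof.
move=> sE tK cK sM; split=> [tb|[bM eM]].
  split; first exact: (totally_bounded_bounded sE tK cK sM tb).
  exact: (totally_bounded_equicontinuous sE tK cK sM tb).
exact: (equicontinuous_totally_bounded sE tK cK sM bM eM).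
Qed.
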